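(* Let $J\in\widetilde Q$ be a compatible para-complex structure and $(h_1,h_2)$ a symplectic basis of $H$ such that $J(h_1\otimes e)=h_2\otimes e$ and $J(h_2\otimes e)=h_1\otimes e$ for all $e\in E$. With respect to $(h_1,h_2)$, a subspace $U\subseteq V$ is pure weakly $J$-para-complex if and only if $U=U^{F,T}$ with $F=p_1(U)$ and $T$ a weakly para-complex structure on $F$ (i.e. $T:F\to F$, $T^2=\mathrm{Id}$). In this case: (a) The map $\phi:(F,T)\to(U^{F,T},J)$, $f\mapsto h_1\otimes f+h_2\otimes Tf$, is an isomorphism of weakly para-complex vector spaces. (b) The subspace $U$ is $J$-Hermitian if and only if $F$ is $g_F$-non degenerate, hence necessarily para-complex. In this case the signature of $g|_U$ is always neutral and $\phi:(F,T,g_F)\to(U,J,g|_U)$ is an isomorphism of Hermitian para-complex spaces; in particular $T$ is $g_F$-skew-symmetric. (c) The para-Kaehler form is given by $$\phi^*(g|_U\circ J)=g_F\circ T=-\bigl(\omega^E|_F-\omega^E|_F(T\,\cdot,T\,\cdot)\bigr).$$ (d) The para-complex subspace $(U,J)$ is totally para-complex if and only if $T$ is $\omega^E|_F$-skew-symmetric and $F$ is $\omega^E|_F$-symplectic. The condition that $T$ is $\omega^E|_F$-skew-symmetric is equivalent to $\omega^E|_F$ being skew-invariant with respect to $T$, i.e. $\omega^E(f,f')=-\omega^E(Tf,Tf')$ for all $f,f'\in F$, and also equivalent to $g_F=-2\,\omega^E|_F\circ T$.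
   Context: $H$ is a real vector space of dimension $2$ with symplectic form $\omega^H$, $E$ a real vector space of dimension $2n$ with symplectic form $\omega^E$; $V=H\otimes E$ with $\widetilde Q=\mathfrak{sl}(H)\otimes\mathrm{Id}\subset\mathrm{End}(V)$ and $g=\omega^H\otimes\omega^E$, i.e. $g(h\otimes e,h'\otimes e')=\omega^H(h,h')\omega^E(e,e')$ (a neutral scalar product for which all elements of $\widetilde Q$ are skew-symmetric). A symplectic basis $(h_1,h_2)$ of $H$ is one with $\omega^H=h_1^*\wedge h_2^*$, i.e. $\omega^H(h_1,h_2)=1$. Given it, each $X\in V$ is uniquely $X=h_1\otimes e+h_2\otimes e'$, and $p_1(X)=e$, $p_2(X)=e'$. For a symplectic basis $(h_1,h_2)$, a subspace $F\subseteq E$ and a linear map $T:F\to E$, $U^{F,T}=\{h_1\otimes f+h_2\otimes Tf: f\in F\}$. With $\phi(f)=h_1\otimes f+h_2\otimes Tf$, $g_F=\phi^*(g|_U)$ is the (possibly degenerate) pulled-back symmetric form on $F$. A compatible para-complex structure is $J\in\widetilde Q$ with $J^2=\mathrm{Id}$; a compatible complex structure is $I\in\widetilde Q$ with $I^2=-\mathrm{Id}$. A weakly para-complex structure on a vector space is an endomorphism with square $\mathrm{Id}$ ($\pm\mathrm{Id}$ allowed); it is para-complex if its $+1$ and $-1$ eigenspaces have equal dimension. A subspace $U$ is weakly $J$-para-complex, written $(U,J)$, if $JU\subseteq U$; it is para-complex if moreover the $\pm1$ eigenspaces of $J|_U$ have equal dimension. A subspace is para-quaternionic if it is invariant under all of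 $\widetilde Q$; a subspace is pure if it contains no nonzero para-quaternionic subspace. $U$ is $J$-Hermitian if it is $J$-para-complex and $g|_U$ is non degenerate ($J|_U$ is then automatically $g|_U$-skew-symmetric). A $J$-Hermitian para-complex subspace $(U,J)$ is totally para-complex if there exists a complex structure $I\in\widetilde Q$ anticommuting with $J$ such that $IU\perp U$. For a bilinear form $b$ and an endomorphism $S$, $(b\circ S)(x,y)=b(Sx,y)$; $S$ is $b$-skew-symmetric if $b(Sx,y)=-b(x,Sy)$ for all $x,y$. Neutral signature means equally many positive and negative directions. $F$ is symplectic if $\omega^E|_F$ is non degenerate. *)

(* Defs.v *)
From HB Require Import structures.
From mathcomp Require Import all_boot all_order all_algebra sesquilinear reals.

Set Implicit Arguments.
Unset Strict Implicit.
Unset Printing Implicit Defensive.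

Import GRing.Theory VectorInternalTheory.

Local Open Scope ring_scope.

(* H (x) E is realised as the space of matrices indexed by the coordinates of
   H and E; [tlift_tensv] and [tensv_ext] prove its universal property. *)
Definition tensor (R : realType) (H E : vectType R) : vectType R :=
  'M[R]_(dim H, dim E).

Definition tensv (R : realType) (H E : vectType R) (h : H) (e : E) :
    tensor H E :=
  (v2r h)^T *m v2r e.

Definition tlift_fun (R : realType) (H E W : vectType R) (B : H -> E -> W)
    (X : tensor H E) : W :=
  \sum_i \sum_j X i j *: B (r2v (delta_mx 0 i)) (r2v (delta_mx 0 j)).

Definition tlift (R : realType) (H E W : vectType R) (B : H -> E -> W) :
    'Hom(tensor H E, W) :=
  linfun (tlift_fun B).

Section TensorTheory.
Variables (R : realType) (H E W : vectType R).
Implicit Types (h : H) (e : E) (X : tensor H E) (B : {bilinear H -> E -> W}).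

Fact tlift_fun_linear (B : H -> E -> W) : linear (tlift_fun B).
Proof.
move=> a X Y; rewrite /tlift_fun scaler_sumr -big_split /=.
apply: eq_bigr => i _; rewrite scaler_sumr -big_split /=.
by apply: eq_bigr => j _; rewrite !mxE scalerDl scalerA.
Qed.

HB.instance Definition _ (B : H -> E -> W) :=
  GRing.isLinear.Build R (tensor H E) W _ (tlift_fun B) (tlift_fun_linear B).

Lemma tensv_bilinear : bilinear_for *:%R *:%R (@tensv R H E).
Proof.
split=> [e a h h' | h a e e'].
- by rewrite /tensv linearP linearP mulmxDl -scalemxAl.
- by rewrite /tensv linearP mulmxDr -scalemxAr.
Qed.

HB.instance Definition _ :=
  bilinear_isBilinear.Build R H E (tensor H E) *:%R *:%R (@tensv R H E)
    tensv_bilinear.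
HB.instance Definition _ (h : H) :=
  GRing.isLinear.Build R E (tensor H E) _ (@tensv R H E h)
    (tensv_bilinear.2 h).

Lemma v2r_sum (vT : vectType R) (v : vT) :
  v = \sum_i v2r v 0 i *: r2v (delta_mx 0 i).
Proof.
rewrite -[LHS]v2rK [v2r v in LHS]row_sum_delta linear_sum.
by apply: eq_bigr => i _; rewrite linearZ.
Qed.

Lemma tlift_tensv B h e : tlift B (tensv h e) = B h e.
Proof.
rewrite lfunE /= /tlift_fun {2}(v2r_sum h) linear_sumlz /=.
apply: eq_bigr => i _; rewrite linearZl_LR /= {2}(v2r_sum e) linear_sumr.
rewrite scaler_sumr; apply: eq_bigr => j _.
by rewrite linearZr_LR /= scalerA mxE big_ord1 mxE.
Qed.

Lemma tensv_ext (f f' : 'Hom(tensor H E, W)) :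
  (forall h e, f (tensv h e) = f' (tensv h e)) -> f = f'.
Proof.
move=> eqf; apply/lfunP => X.
have -> : X = \sum_i \sum_j X i j *:
              tensv (r2v (delta_mx 0 i) : H) (r2v (delta_mx 0 j) : E).
  rewrite {1}[X]matrix_sum_delta; apply: eq_bigr => i _; apply: eq_bigr => j _.
  by rewrite /tensv !r2vK trmx_delta mul_delta_mx.
rewrite !linear_sum; apply: eq_bigr => i _; rewrite !linear_sum.
by apply: eq_bigr => j _; rewrite !linearZ /= eqf.
Qed.
End TensorTheory.

Definition pullback (R : realType) (W W' : vectType R) (b : W -> W -> R)
    (f : 'Hom(W', W)) (x y : W') : R :=
  b (f x) (f y).

Section PullbackForm.
Variables (R : realType) (W W' : vectType R) (eps : bool).
Variables (b : {hermitian W for eps & idfun}) (f : 'Hom(W', W)).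

Fact pullback_bilinear :
  bilinear_for *%R (idfun \; *%R) (pullback b f : W' -> W' -> R).
Proof.
split=> [y a x x' | x a y y']; rewrite /pullback linearP.
- by rewrite linearPl.
- by rewrite linearPr.
Qed.
HB.instance Definition _ :=
  bilinear_isBilinear.Build R W' W' R *%R (idfun \; *%R) (pullback b f)
    pullback_bilinear.

Fact pullback_herm x y :
  pullback b f x y = (-1) ^+ eps * idfun (pullback b f y x).
Proof. exact: hermC. Qed.
HB.instance Definition _ :=
  isHermitianSesquilinear.Build R W' eps idfun (pullback b f) pullback_herm.
End PullbackForm.

(* The Gram matrix of b in the coordinates of W. *)
Definition gram (R : realType) (W : vectType R) (b : W -> W -> R) :
    'M[R]_(dim W) :=
  \matrix_(i, j) b (r2v (delta_mx 0 i)) (r2v (delta_mx 0 j)).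

(* The tensor product of two bilinear forms, characterised by
   [tform_tensv] below. *)
Definition tform (R : realType) (H E : vectType R)
    (oH : H -> H -> R) (oE : E -> E -> R) (X Y : tensor H E) : R :=
  \tr ((X : 'M_(dim H, dim E))^T *m gram oH *m Y *m (gram oE)^T).

Section TensorForm.
Variables (R : realType) (H E : vectType R).
Variables (oH : {skew_symmetric H}) (oE : {skew_symmetric E}).

Lemma gram_skew (W : vectType R) (b : {skew_symmetric W}) :
  (gram b)^T = - gram b.
Proof. by apply/matrixP => i j; rewrite !mxE hermC expr1 mulN1r. Qed.

Lemma gramE (W : vectType R) (b : {skew_symmetric W}) (x y : W) :
  v2r x *m gram b *m (v2r y)^T = (b x y)%:M.
Proof.
apply/matrixP => i j; rewrite !ord1 !mxE eqxx mulr1n.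
rewrite [in RHS](v2r_sum y) linear_sumr; apply: eq_bigr => k _.
rewrite linearZr_LR /= !mxE [in RHS](v2r_sum x) linear_sumlz mulrC.
congr (_ * _); apply: eq_bigr => l _.
by rewrite linearZl_LR /= mxE.
Qed.

Fact tform_bilinear :
  bilinear_for *%R (idfun \; *%R) (tform oH oE : tensor H E -> _ -> R).
Proof.
split=> [Y a X X' | X a Y Y']; rewrite /tform.
- by rewrite linearP !mulmxDl -!scalemxAl linearP.
- by rewrite mulmxDr mulmxDl -scalemxAr -scalemxAl linearP.
Qed.
HB.instance Definition _ :=
  bilinear_isBilinear.Build R (tensor H E) (tensor H E) R *%R (idfun \; *%R)
    (tform oH oE) tform_bilinear.

Fact tform_sym (X Y : tensor H E) :
  tform oH oE X Y = (-1) ^+ false * idfun (tform oH oE Y X).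
Proof.
rewrite mul1r /= /tform -mxtrace_tr !trmx_mul !trmxK !gram_skew.
rewrite !(mulmxN, mulNmx) !linearN /=; congr (- _).
by rewrite mxtrace_mulC !mulmxA.
Qed.
HB.instance Definition _ :=
  isHermitianSesquilinear.Build R (tensor H E) false idfun (tform oH oE)
    tform_sym.

Lemma tform_tensv (h h' : H) (e e' : E) :
  tform oH oE (tensv h e) (tensv h' e') = oH h h' * oE e e'.
Proof.
rewrite /tform /tensv trmx_mul trmxK.
have -> : (v2r e)^T *m v2r h *m gram oH *m ((v2r h')^T *m v2r e') *m
            (gram oE)^T
  = (v2r e)^T *m (v2r h *m gram oH *m (v2r h')^T) *m (v2r e' *m (gram oE)^T).
  by rewrite !mulmxA.
rewrite gramE mul_mx_scalar -scalemxAl mxtraceZ mxtrace_mulC.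
by rewrite -mxtrace_tr !trmx_mul !trmxK mulmxA gramE mxtrace_scalar mulr1n.
Qed.
End TensorForm.

Section Subobjects.
Variables (R : realType) (W W' : vectType R) (U : {vspace W}).

Definition incl : 'Hom(subvs_of U, W) := linfun vsval.

(* f with its codomain restricted to U; meaningful when U contains the image
   of f, see [corestrE]. *)
Definition corestr (f : 'Hom(W', W)) : 'Hom(W', subvs_of U) :=
  (linfun (vsproj U) \o f)%VF.

Lemma corestrE (f : 'Hom(W', W)) x : f x \in U -> vsval (corestr f x) = f x.
Proof. by move=> fxU; rewrite /corestr comp_lfunE lfunE /= vsprojK. Qed.
End Subobjects.

(* S|_U, meaningful when S U is contained in U. *)
Definition restr (R : realType) (W : vectType R) (U : {vspace W})
    (S : 'End(W)) : 'End(subvs_of U) :=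
  corestr U (S \o incl U)%VF.

Notation form_on b U := (pullback b (incl U)).

Section Structures.
Variables (R : realType) (W W' : vectType R).

Definition weakly_para_complex (T : 'End(W)) : Prop := (T \o T)%VF = \1%VF.

Definition para_complex (T : 'End(W)) : Prop :=
  weakly_para_complex T /\
  \dim (passmx.leigenspace T 1) = \dim (passmx.leigenspace T (-1)).

Definition skew_wrt (b : W -> W -> R) (S : 'End(W)) : Prop :=
  forall x y, b (S x) y = - b x (S y).

Definition hermitian_para_complex (T : 'End(W)) (b : {symmetric W}) : Prop :=
  [/\ para_complex T, nondegenerate b & skew_wrt b T].

(* A pseudo-orthonormal basis with p vectors of square 1 and q of square -1. *)
Definition has_signature (b : W -> W -> R) (p q : nat) : Prop :=
  exists2 X : (p + q).-tuple W, basis_of {:W} X &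
    forall i j : 'I_(p + q),
      b X`_i X`_j = if i == j then (if (i < p)%N then 1 else -1) else 0.

Definition neutral (b : W -> W -> R) : Prop := exists m, has_signature b m m.
End Structures.

Definition weakly_para_complex_iso (R : realType) (W W' : vectType R)
    (T : 'End(W)) (T' : 'End(W')) (f : 'Hom(W, W')) : Prop :=
  [/\ weakly_para_complex T, weakly_para_complex T', bijective f
    & forall x, f (T x) = T' (f x)].

Definition hermitian_para_complex_iso (R : realType) (W W' : vectType R)
    (T : 'End(W)) (b : {symmetric W}) (T' : 'End(W')) (b' : {symmetric W'})
    (f : 'Hom(W, W')) : Prop :=
  [/\ hermitian_para_complex T b, hermitian_para_complex T' b',
      weakly_para_complex_iso T T' f
    & forall x y, b' (f x) (f y) = b x y].

(* The trace does not depend on the basis used to compute it. *)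
Definition lfun_trace (R : realType) (W : vectType R) (A : 'End(W)) : R :=
  \tr (passmx.mxof (vbasis {:W}) (vbasis {:W}) A).

Section ParaQuaternionic.
Variables (R : realType) (H E : vectType R).
Implicit Types (U : {vspace tensor H E}) (J I S : 'End(tensor H E)).

(* S belongs to sl(H) (x) Id. *)
Definition in_Qt S : Prop :=
  exists2 A : 'End(H), lfun_trace A = 0 &
    forall (h : H) (e : E), S (tensv h e) = tensv (A h) e.

Definition compatible_para_complex J : Prop :=
  in_Qt J /\ (J \o J)%VF = \1%VF.

Definition compatible_complex I : Prop :=
  in_Qt I /\ (I \o I)%VF = (- \1)%VF.

Definition para_quaternionic U : Prop :=
  forall S, in_Qt S -> (S @: U <= U)%VS.

Definition pure U : Prop :=
  forall U' : {vspace tensor H E},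
    (U' <= U)%VS -> para_quaternionic U' -> U' = 0%VS.

Definition weakly_para_complex_sub U J : Prop := (J @: U <= U)%VS.

Definition para_complex_sub U J : Prop :=
  weakly_para_complex_sub U J /\
  \dim (passmx.leigenspace (restr U J) 1) =
  \dim (passmx.leigenspace (restr U J) (-1)).

Variable g : {symmetric tensor H E}.

Definition hermitian_sub U J : Prop :=
  para_complex_sub U J /\ nondegenerate (form_on g U).

Definition totally_para_complex_sub U J : Prop :=
  hermitian_sub U J /\
  exists I, [/\ compatible_complex I, (I \o J)%VF = (- (J \o I))%VF
             & (I @: U <= orthov g U)%VS].
End ParaQuaternionic.

Definition symplectic_basis (R : realType) (H : vectType R)
    (oH : H -> H -> R) (h1 h2 : H) : Prop :=
  basis_of {:H} [:: h1; h2] /\ oH h1 h2 = 1.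

Definition coordZ (R : realType) (H E : vectType R) (h1 h2 : H) (i : 'I_2)
    (h : H) (e : E) : E :=
  coord [tuple h1; h2] i h *: e.

(* [tproj h1 h2 0] and [tproj h1 h2 1] are the projections p_1 and p_2, that
   is h_1^* (x) Id and h_2^* (x) Id; see [tproj_decomp], [tproj1E] and
   [tproj2E]. *)
Definition tproj (R : realType) (H E : vectType R) (h1 h2 : H) (i : 'I_2) :
    'Hom(tensor H E, E) :=
  tlift (@coordZ R H E h1 h2 i).

Section Projections.
Variables (R : realType) (H E : vectType R) (h1 h2 : H).

Fact coordZ_bilinear i :
  bilinear_for *:%R *:%R (@coordZ R H E h1 h2 i).
Proof.
split=> [e a h h' | h a e e']; rewrite /coordZ /=.
- by rewrite linearP scalerDl /= scalerA.
- by rewrite scalerDr !scalerA mulrC.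
Qed.
HB.instance Definition _ i :=
  bilinear_isBilinear.Build R H E E *:%R *:%R
    (@coordZ R H E h1 h2 i) (coordZ_bilinear i).

Lemma tproj_tensv i (h : H) (e : E) :
  tproj E h1 h2 i (tensv h e) = coord [tuple h1; h2] i h *: e.
Proof. exact: tlift_tensv. Qed.

Hypothesis h_basis : basis_of {:H} [:: h1; h2].

Lemma tproj_decomp (X : tensor H E) :
  X = tensv h1 (tproj E h1 h2 0 X) + tensv h2 (tproj E h1 h2 1 X).
Proof.
pose Id' : 'Hom(tensor H E, tensor H E) :=
  ((linfun (@tensv R H E h1) \o tproj E h1 h2 0)
   + (linfun (@tensv R H E h2) \o tproj E h1 h2 1))%VF.
have IdE Y : Id' Y = tensv h1 (tproj E h1 h2 0 Y) + tensv h2 (tproj E h1 h2 1 Y).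
  rewrite add_lfunE !comp_lfunE.
  by rewrite (lfunE (@tensv R H E h1)) (lfunE (@tensv R H E h2)).
suff eqId : Id' = \1%VF by rewrite -IdE eqId id_lfunE.
apply: tensv_ext => h e.
rewrite IdE id_lfunE !tproj_tensv !linearZr_LR /=.
rewrite [in RHS](coord_basis (h_basis : basis_of _ [tuple h1; h2]) (memvf h)).
rewrite big_ord_recl big_ord1 linearDl !linearZl_LR /=.
by congr (coord _ _ _ *: _ + coord _ _ _ *: _); apply: val_inj.
Qed.

Lemma tproj1E (e e' : E) : tproj E h1 h2 0 (tensv h1 e + tensv h2 e') = e.
Proof.
have fr := basis_free (h_basis : basis_of _ [tuple h1; h2]).
rewrite linearD /= !tproj_tensv.
have /= -> := coord_free 0 0 fr; have /= -> := coord_free 1 0 fr.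
by rewrite scale1r scale0r addr0.
Qed.

Lemma tproj2E (e e' : E) : tproj E h1 h2 1 (tensv h1 e + tensv h2 e') = e'.
Proof.
have fr := basis_free (h_basis : basis_of _ [tuple h1; h2]).
rewrite linearD /= !tproj_tensv.
have /= -> := coord_free 0 1 fr; have /= -> := coord_free 1 1 fr.
by rewrite scale1r scale0r add0r.
Qed.
End Projections.

Section UFT.
Variables (R : realType) (H E : vectType R) (h1 h2 : H) (F : {vspace E}).

Definition phi_fun (T : 'Hom(subvs_of F, E)) (f : subvs_of F) : tensor H E :=
  tensv h1 (vsval f) + tensv h2 (T f).

Fact phi_fun_linear (T : 'Hom(subvs_of F, E)) : linear (phi_fun T).
Proof.
move=> a x y; rewrite /phi_fun !linearP /=.
by rewrite scalerDr addrACA.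
Qed.
HB.instance Definition _ (T : 'Hom(subvs_of F, E)) :=
  GRing.isLinear.Build R (subvs_of F) (tensor H E) _ (phi_fun T)
    (phi_fun_linear T).

Definition phi (T : 'Hom(subvs_of F, E)) : 'Hom(subvs_of F, tensor H E) :=
  linfun (phi_fun T).

Definition UFT (T : 'Hom(subvs_of F, E)) : {vspace tensor H E} := limg (phi T).

Lemma phiE T f : phi T f = tensv h1 (vsval f) + tensv h2 (T f).
Proof. by rewrite lfunE. Qed.

(* An endomorphism of F seen as a map F -> E. *)
Definition endE (T : 'End(subvs_of F)) : 'Hom(subvs_of F, E) :=
  (incl F \o T)%VF.
End UFT.

(* Main.v *)
(** Since [J X = h1 (x) p2 X + h2 (x) p1 X], every [e] with [h2 (x) e] in a
    [J]-stable [U] also has [h1 (x) e] in [U], so purity of [U] says exactly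
    that [p1] is injective on [U]; the inverse of [p1] followed by [J] and [p1]
    is then the structure [T]. Conversely, the rotation
    [h1 |-> h2, h2 |-> -h1] in [sl(H)] separates the two components of a vector
    of [UFT T], so a para-quaternionic subspace of [UFT T] is zero.

    On [F] the metric is [g_F f f' = oE f (T f') - oE (T f) f'], for which [T]
    is skew. The eigenspaces of [T] are thus isotropic and, when [g_F] is non
    degenerate, dual to each other, whence the equality of dimensions and the
    neutral signature. If [I] anticommutes with [J], then it is
    [h1 |-> a h1 + c h2, h2 |-> - c h1 - a h2] with [a^2 - c^2 = -1];
    orthogonality of [I U] and [U] reads [a S = c P] for the forms
    [S f f' = oE f (T f') + oE (T f) f'] and [P f f' = S (T f) f'], hence also
    [a P = c S], and so [- S = (a^2 - c^2) S = 0]. *)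
From HB Require Import structures.
Require Import Defs.
From mathcomp Require Import all_boot all_order all_algebra sesquilinear reals.
From mathcomp Require Import ring lra.

Set Implicit Arguments.
Unset Strict Implicit.
Unset Printing Implicit Defensive.

Import GRing.Theory Num.Theory passmx.

Local Open Scope ring_scope.

Lemma nondegenerateP (R : realType) (W : vectType R) (eps : bool)
    (b : {hermitian W for eps & idfun}) :
  reflect (forall x, (forall y, b x y = 0) -> x = 0) (nondegenerate b).
Proof.
apply: (iffP eqP) => [rad0 x bx0 | nd].
  apply/eqP; rewrite -memv0 -rad0; apply/mem_orthovP => y _; exact: bx0.
apply/eqP; rewrite -subv0; apply/subvP => x /mem_orthovP x_rad.
by rewrite memv0; apply/eqP/nd => y; apply: x_rad; rewrite memvf.
Qed.

(** * Involutions that are skew for a symmetric form *)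

Section Eigen.
Variables (R : realType) (W : vectType R).
Implicit Types (T : 'End(W)) (b : {symmetric W}).

Lemma weakly_para_complexE T : weakly_para_complex T <-> forall x, T (T x) = x.
Proof.
split=> [TT x | TT]; first by rewrite -comp_lfunE TT id_lfunE.
by apply/lfunP => x; rewrite comp_lfunE id_lfunE.
Qed.

Lemma mem_leigenspace T (a : R) x :
  (x \in leigenspace T a) = (T x == a *: x).
Proof.
by rewrite memv_ker add_lfunE opp_lfunE scale_lfunE id_lfunE subr_eq0.
Qed.

(** Skewness gives [a * b x y = - (a * b x y)]. *)
Lemma skew_wrt_eigen_isotropic b T (a : R) x y : skew_wrt b T -> a != 0 ->
  x \in leigenspace T a -> y \in leigenspace T a -> b x y = 0.
Proof.
rewrite !mem_leigenspace => skT a0 /eqP Tx /eqP Ty; have := skT x y.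
rewrite Tx Ty linearZl_LR linearZr_LR /= => h.
have : a * b x y = 0 by lra.
by move/eqP; rewrite mulf_eq0 (negPf a0) => /eqP.
Qed.

Lemma para_complex_split T x : weakly_para_complex T ->
  exists y z, [/\ y \in leigenspace T 1, z \in leigenspace T (-1)
    & x = y + z].
Proof.
move=> /weakly_para_complexE TT.
exists (2^-1 *: (x + T x)), (2^-1 *: (x - T x)); split.
- by rewrite mem_leigenspace linearZ linearD /= TT scale1r addrC.
- by rewrite mem_leigenspace linearZ linearB /= TT scaleN1r -scalerN opprB.
- rewrite -scalerDr addrACA subrr addr0 -mulr2n -scaler_nat scalerA.
  by rewrite mulVf ?scale1r ?pnatr_eq0.
Qed.

(** The map [y |-> (b X_i y)_i] is injective on [U] by hypothesis, whence the bound; in case of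
    equality it is onto, and preimages of the unit vectors form the dual family. *)
Lemma dual_family b m (X : m.-tuple W) (U : {vspace W}) :
    {in U, forall y, (forall i : 'I_m, b X`_i y = 0) -> y = 0} ->
  (\dim U <= m)%N /\
  (\dim U = m -> exists Y : 'I_m -> W,
     forall j, Y j \in U /\ forall i : 'I_m, b X`_i (Y j) = (i == j)%:R).
Proof.
move=> sepU.
pose f (y : W) : 'rV[R]_m := \row_i b X`_i y.
have f_lin : linear f.
  by move=> a y z; apply/rowP => i; rewrite !mxE linearP.
pose f' := GRing.isLinear.Build R W 'rV[R]_m _ f f_lin.
pose fL : {linear W -> 'rV[R]_m} := HB.pack f f'.
have fE y i : (linfun fL) y 0 i = b X`_i y by rewrite lfunE /= mxE.
have ker0 : (U :&: lker (linfun fL) = 0)%VS.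
  apply/eqP; rewrite -subv0; apply/subvP => y /memv_capP[yU].
  rewrite memv_ker memv0 => /eqP fy0; apply/eqP/sepU => // i.
  by rewrite -fE fy0 mxE.
have := limg_ker_dim (linfun fL) U; rewrite ker0 dimv0 add0n => dimU.
have dim_full : \dim {:'rV[R]_m} = m by rewrite dimvf /dim /= mul1n.
split=> [|Um]; first by rewrite -dimU -[leqRHS]dim_full dimvS ?subvf.
have imU : (linfun fL @: U = fullv)%VS.
  by apply/eqP; rewrite eqEdim subvf dim_full dimU Um /=.
suff /fin_all_exists[Y YP] : forall j, exists y,
  y \in U /\ forall i : 'I_m, b X`_i y = (i == j)%:R by exists Y.
move=> j.
have /memv_imgP[y yU fy] : delta_mx 0 j \in (linfun fL @: U)%VS.
  by rewrite imU memvf.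
by exists y; split=> // i; rewrite -fE -fy mxE eqxx.
Qed.

(** The vector [y] is orthogonal to its own eigenspace by isotropy and to the other one by
    hypothesis; the two span the space, so [y] lies in the radical. *)
Lemma eigen_pairing b T (a : R) y :
    nondegenerate b -> weakly_para_complex T -> skew_wrt b T ->
    a = 1 \/ a = -1 -> y \in leigenspace T (- a) ->
  {in leigenspace T a, forall x, b x y = 0} -> y = 0.
Proof.
move=> /nondegenerateP nd wT skT a1 yNa orth.
have Na0 : - a != 0 by case: a1 => ->; rewrite ?opprK ?oppr_eq0 oner_neq0.
have orthN x : x \in leigenspace T (- a) -> b x y = 0.
  by move=> xNa; apply: skew_wrt_eigen_isotropic skT Na0 xNa yNa.
apply: nd => x; rewrite hermC mul1r /=.
have [u [v [u1 vN1 ->]]] := para_complex_split x wT.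
rewrite linearDl /=; case: a1 => a_eq; rewrite a_eq ?opprK in orth orthN.
  by rewrite orth ?orthN ?addr0.
by rewrite orthN ?orth ?addr0.
Qed.

(** Taken at both signs of [a], the inequality yields equal dimensions; the second clause then
    supplies the dual bases behind the signature. *)
Lemma eigen_duality b T (a : R) :
    nondegenerate b -> weakly_para_complex T -> skew_wrt b T ->
    a = 1 \/ a = -1 ->
  (\dim (leigenspace T (- a)%R) <= \dim (leigenspace T a))%N /\
  (\dim (leigenspace T (- a)%R) = \dim (leigenspace T a) ->
   exists Y : 'I_(\dim (leigenspace T a)) -> W, forall j,
     Y j \in leigenspace T (- a) /\
     forall i : 'I__, b (vbasis (leigenspace T a))`_i (Y j) = (i == j)%:R).
Proof.
move=> nd wT skT a1; apply: dual_family => y yNa orth.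
apply: (eigen_pairing nd wT skT a1 yNa) => x /coord_vbasis ->.
by rewrite linear_sumlz big1 // => i _; rewrite linearZl_LR /= orth mulr0.
Qed.

Lemma skew_para_complex b T :
    nondegenerate b -> weakly_para_complex T -> skew_wrt b T ->
  para_complex T.
Proof.
move=> nd wT skT; split=> //; apply/eqP; rewrite eqn_leq.
have [leN _] := eigen_duality nd wT skT (or_introl erefl).
have [] := eigen_duality nd wT skT (or_intror erefl); rewrite opprK => leP _.
by rewrite leN leP.
Qed.

(** A basis [e i] of the eigenspace for 1 and its dual family [Y i] in the eigenspace for -1 span
    mutually orthogonal hyperbolic planes, each with one direction of either sign. *)
Lemma skew_neutral b T :
    nondegenerate b -> weakly_para_complex T -> skew_wrt b T ->
  neutral b.
Proof.
move=> nd wT skT; have [_ eq_dim] := skew_para_complex nd wT skT.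
have [_ /(_ (esym eq_dim)) [Y Y_dual]] :=
  eigen_duality nd wT skT (or_introl erefl).
set F1 := leigenspace T 1 in eq_dim Y Y_dual.
set m : nat := \dim F1 in Y Y_dual.
pose e (i : 'I_m) : W := (vbasis F1)`_i.
have eF1 i : e i \in F1 by rewrite vbasis_mem // mem_nth // size_tuple.
have ee i j : b (e i) (e j) = 0.
  exact: skew_wrt_eigen_isotropic skT (oner_neq0 _) (eF1 i) (eF1 j).
have YY i j : b (Y i) (Y j) = 0.
  apply: skew_wrt_eigen_isotropic skT _ (Y_dual i).1 (Y_dual j).1.
  by rewrite oppr_eq0 oner_neq0.
have eY i j : b (e i) (Y j) = (i == j)%:R by rewrite (Y_dual j).2.
have Ye i j : b (Y i) (e j) = (i == j)%:R by rewrite hermC mul1r /= eY eq_sym.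
(* The square of [e i + s *: Y i] is [2 * s], hence the coefficients 1/2 and -1/2. *)
pose x (k : 'I_(m + m)) : W :=
  match split k with
  | inl i => e i + 2^-1 *: Y i
  | inr i => e i + (- 2^-1) *: Y i
  end.
pose X := [tuple x k | k < m + m].
have XE (k : 'I_(m + m)) : X`_k = x k by rewrite -tnth_nth tnth_mktuple.
have bst (s t : R) i j :
    b (e i + s *: Y i) (e j + t *: Y j) = (s + t) * (i == j)%:R.
  rewrite linearDl /= !linearDr /= !linearZl_LR /= !linearZr_LR /=.
  by rewrite ee eY Ye YY; ring.
have half2 : 2^-1 + 2^-1 = 1 :> R by lra.
have bX (i j : 'I_(m + m)) :
    b X`_i X`_j = if i == j then (if (i < m)%N then 1 else -1) else 0.
  rewrite !XE /x.
  have -> : (i == j) = (split i == split j) by rewrite (can_eq (@splitK m m)).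
  case: (splitP i) => i' _; case: (splitP j) => j' _; rewrite bst.
  - by rewrite half2 mul1r -[inl i' == _]/(i' == j'); case: (i' == j').
  - by rewrite subrr mul0r.
  - by rewrite addNr mul0r.
  - rewrite -opprD half2 mulN1r -[inr i' == _]/(i' == j').
    by case: (i' == j'); rewrite ?oppr0.
exists m, X => //; rewrite basisEfree subvf size_tuple; apply/andP; split.
  (* Pairing with [X_i] leaves only the i-th coefficient, up to sign. *)
  apply/freeP => k sum0 i.
  have := bX i i; rewrite eqxx => bii.
  have : b X`_i (\sum_(j < m + m) k j *: X`_j) = 0 by rewrite sum0 linear0r.
  rewrite linear_sumr (bigD1 i) //= linearZr_LR /= bii big1 => [|j ij].
    by case: ifP => _; lra.
  by rewrite linearZr_LR /= bX eq_sym (negPf ij) mulr0.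
(* The two eigenspaces, both of dimension [m], fill the space, so [m + m] free vectors suffice. *)
have -> : fullv = (F1 + leigenspace T (-1))%VS.
  apply/eqP; rewrite eqEsubv subvf andbT; apply/subvP => z _.
  by have [u [v [uF vF ->]]] := para_complex_split z wT; rewrite memv_add.
by apply: leq_trans (dimv_add_leqif _ _) _; rewrite -eq_dim.
Qed.
End Eigen.

(** * The rotation of H and its action on the tensor product *)

Section Rotation.
Variables (R : realType) (H E : vectType R) (h1 h2 : H).
Hypothesis h_basis : basis_of {:H} [:: h1; h2].
Implicit Types (X : tensor H E) (s t : R) (h : H) (e : E).

Local Notation c0 := (coord [tuple h1; h2] (0 : 'I_2)).
Local Notation c1 := (coord [tuple h1; h2] (1 : 'I_2)).
Local Notation p1 := (tproj E h1 h2 0).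
Local Notation p2 := (tproj E h1 h2 1).

(** By cyclicity, [A = A P P] has the same trace as [P A P = - A]. This avoids computing in
    [vbasis], the basis used by [lfun_trace], which is unrelated to [h1] and [h2]. *)
Lemma trace_anticommute (P A : 'End(H)) :
  (P \o P)%VF = \1%VF -> (A \o P)%VF = (- (P \o A))%VF -> lfun_trace A = 0.
Proof.
move=> PP AP; have b_basis := vbasisP {:H}.
have trC (B C : 'End(H)) : lfun_trace (B \o C) = lfun_trace (C \o B).
  by rewrite /lfun_trace !(mxof_comp _ _ b_basis) mxtrace_mulC.
have trN (B : 'End(H)) : lfun_trace (- B) = - lfun_trace B.
  by rewrite /lfun_trace !linearN.
have trA : lfun_trace A = lfun_trace ((A \o P) \o P).
  by rewrite -comp_lfunA PP comp_lfun1r.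
have : lfun_trace A = - lfun_trace A.
  by rewrite {1}trA AP comp_lfunNl trN -comp_lfunA trC -trA.
by move=> ?; lra.
Qed.

(* For s = -1 this is the rotation h1 |-> h2, h2 |-> - h1, which has trace 0
   because it anticommutes with the involution obtained for s = 1. *)
Definition swap_fun s h : H := c0 h *: h2 + (s * c1 h) *: h1.

Fact swap_fun_linear s : linear (swap_fun s).
Proof.
move=> a x y; rewrite /swap_fun (linearP c0) (linearP c1) /= mulrDr.
by rewrite !scalerDl scalerDr !scalerA addrACA mulrCA.
Qed.
HB.instance Definition _ s :=
  GRing.isLinear.Build R H H _ (swap_fun s) (swap_fun_linear s).

Definition swap s : 'End(H) := linfun (swap_fun s).

Lemma swapE s a b : swap s (a *: h1 + b *: h2) = (s * b) *: h1 + a *: h2.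
Proof.
have fr := basis_free (h_basis : basis_of _ [tuple h1; h2]).
rewrite lfunE /= /swap_fun !linearD !linearZ /=.
have /= -> := coord_free 0 0 fr; have /= -> := coord_free 1 0 fr.
have /= -> := coord_free 0 1 fr; have /= -> := coord_free 1 1 fr.
by rewrite addrC; congr (_ *: _ + _ *: _) => /=; ring.
Qed.

Lemma basis2E h : h = c0 h *: h1 + c1 h *: h2.
Proof.
rewrite [LHS](coord_basis (h_basis : basis_of _ [tuple h1; h2]) (memvf h)).
rewrite big_ord_recl big_ord1 /=.
by congr (coord _ _ _ *: _ + coord _ _ _ *: _); apply: val_inj.
Qed.

Lemma swapN1_trace : lfun_trace (swap (-1)) = 0.
Proof.
apply: (@trace_anticommute (swap 1)); apply/lfunP => h;
  rewrite !(comp_lfunE, opp_lfunE, id_lfunE) [h]basis2E !swapE ?mul1r //.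
by rewrite !mulN1r opprD !scaleNr opprK.
Qed.

(** This is [swap (-1)] tensored with the identity of [E], written with the projections so that its
    value on any tensor is explicit. *)
Definition rotation : 'End(tensor H E) :=
  ((linfun (@tensv R H E h2) \o p1)
   - (linfun (@tensv R H E h1) \o p2))%VF.

Lemma rotationE X : rotation X = tensv h1 (- p2 X) + tensv h2 (p1 X).
Proof.
rewrite add_lfunE opp_lfunE !comp_lfunE.
rewrite (lfunE (@tensv R H E h1)) (lfunE (@tensv R H E h2)) /=.
by rewrite linearNr addrC.
Qed.

Lemma rotation_in_Qt : in_Qt rotation.
Proof.
exists (swap (-1)); first exact: swapN1_trace.
move=> h e; rewrite rotationE !tproj_tensv [in RHS](basis2E h) swapE.
rewrite linearDl /= !linearZl_LR linearNr !linearZr_LR /=.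
by rewrite mulN1r scaleNr.
Qed.

Lemma rotation_complex : compatible_complex rotation.
Proof.
split; first exact: rotation_in_Qt.
apply/lfunP => X; rewrite comp_lfunE opp_lfunE id_lfunE !rotationE.
rewrite tproj1E // tproj2E // [in RHS](tproj_decomp h_basis X) opprD.
by rewrite !linearNr.
Qed.
End Rotation.

Lemma inclE (R : realType) (W : vectType R) (U : {vspace W}) (y : subvs_of U) :
  incl U y = vsval y.
Proof. by rewrite lfunE. Qed.

(** * Metric and anticommuting structures in the basis h1, h2 *)

Section Pencil.
Variables (R : realType) (H E : vectType R).
Variables (oH : {skew_symmetric H}) (oE : {skew_symmetric E}).
Variables (J : 'End(tensor H E)) (h1 h2 : H).
Hypothesis h_symp : symplectic_basis oH h1 h2.
Hypothesis Jh1 : forall e : E, J (tensv h1 e) = tensv h2 e.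
Hypothesis Jh2 : forall e : E, J (tensv h2 e) = tensv h1 e.

Let h_basis : basis_of {:H} [:: h1; h2] := h_symp.1.

Local Notation p1 := (tproj E h1 h2 0).
Local Notation p2 := (tproj E h1 h2 1).
Local Notation g := (tform oH oE : {symmetric tensor H E}).

Lemma swap_tensorE X : J X = tensv h1 (p2 X) + tensv h2 (p1 X).
Proof. by rewrite {1}(tproj_decomp h_basis X) linearD /= Jh1 Jh2 addrC. Qed.

Lemma swap_tensorK X : J (J X) = X.
Proof.
rewrite swap_tensorE (tproj_decomp h_basis X) swap_tensorE.
by rewrite !(tproj1E h_basis) !(tproj2E h_basis).
Qed.

Lemma rotation_swap :
  (rotation E h1 h2 \o J)%VF = (- (J \o rotation E h1 h2))%VF.
Proof.
apply/lfunP => X; rewrite comp_lfunE opp_lfunE comp_lfunE.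
rewrite !rotationE // !swap_tensorE.
by rewrite !(tproj1E h_basis) !(tproj2E h_basis) !linearNr /= opprD opprK.
Qed.

Lemma skew_form_diag (W : vectType R) (b : {skew_symmetric W}) x : b x x = 0.
Proof. by have := hermC b x x; rewrite expr1 mulN1r /= => ?; lra. Qed.

(** Since [oH] vanishes on the diagonal, only the mixed terms survive, with opposite signs. *)
Lemma tformE x y x' y' :
  g (tensv h1 x + tensv h2 y) (tensv h1 x' + tensv h2 y') = oE x y' - oE y x'.
Proof.
have h21 : oH h2 h1 = -1 by rewrite hermC expr1 mulN1r /= h_symp.2.
rewrite linearDl /= !linearDr /= !tform_tensv !skew_form_diag h21 h_symp.2.
by ring.
Qed.

(** The scalars are the coordinates of [A h1]; the value on [h2 (x) y = J (h1 (x) y)] is then forced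
    by anticommutation. *)
Lemma in_Qt_anticommute (I : 'End(tensor H E)) :
    in_Qt I -> (I \o J)%VF = (- (J \o I))%VF ->
  exists a c : R, forall x y,
    I (tensv h1 x + tensv h2 y)
    = tensv h1 (a *: x - c *: y) + tensv h2 (c *: x - a *: y).
Proof.
case=> A _ IA IJ.
pose a := coord [tuple h1; h2] (0 : 'I_2) (A h1).
pose c := coord [tuple h1; h2] (1 : 'I_2) (A h1).
have I1 e : I (tensv h1 e) = tensv h1 (a *: e) + tensv h2 (c *: e).
  by rewrite IA {1}(basis2E h_basis (A h1)) linearDl !linearZl_LR !linearZr_LR.
exists a, c => x y; rewrite linearD /= I1.
have -> : I (tensv h2 y) = - tensv h1 (c *: y) - tensv h2 (a *: y).
  rewrite -Jh1 -comp_lfunE IJ opp_lfunE comp_lfunE I1 linearD /= Jh1 Jh2.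
  by rewrite opprD addrC.
by rewrite addrACA -!linearBr.
Qed.

(** * Geometry of the graph of an involution *)

Section Graph.
Variables (F : {vspace E}) (T : 'End(subvs_of F)).
Hypothesis wT : weakly_para_complex T.

Local Notation ph := (phi h1 h2 (endE T)).
Local Notation U := (UFT h1 h2 (endE T)).
Local Notation f_U := (corestr U ph).
Local Notation w_F := (form_on oE F : {skew_symmetric subvs_of F}).
Local Notation g_U := (form_on g U : {symmetric subvs_of U}).
Local Notation g_F := (pullback g_U f_U : {symmetric subvs_of F}).
Local Notation J_U := (restr U J).

Lemma endE_val f : endE T f = vsval (T f).
Proof. by rewrite comp_lfunE inclE. Qed.

Lemma phi_endE f : ph f = tensv h1 (vsval f) + tensv h2 (vsval (T f)).
Proof. by rewrite phiE endE_val. Qed.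

Let TT : forall f, T (T f) = f := (weakly_para_complexE T).1 wT.

Lemma swap_phi f : J (ph f) = ph (T f).
Proof. by rewrite swap_tensorE !phi_endE TT tproj1E // tproj2E. Qed.

Lemma swap_sub_graph : weakly_para_complex_sub U J.
Proof.
apply/subvP => _ /memv_imgP[_ /memv_imgP[f _ ->] ->].
by rewrite swap_phi memv_img // memvf.
Qed.

Lemma pure_graph : pure U.
Proof.
move=> U' U'U pqU'; apply/eqP; rewrite -subv0; apply/subvP => X XU'.
have /memv_imgP[f _ Xf] := subvP U'U _ XU'.
suff f0 : f = 0 by rewrite Xf f0 linear0 memv0.
have /(subvP U'U) : rotation E h1 h2 X \in U'.
  exact: subvP (pqU' _ (rotation_in_Qt E h_basis)) _ (memv_img _ XU').
(* Comparing the components of [(- T f, f)] and [(f', T f')] gives [f' = - T f], then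
   [f = T f' = - f]. *)
case/memv_imgP => f' _; rewrite rotationE Xf !phi_endE tproj1E // tproj2E //.
move=> eqf; have := congr1 p1 eqf; have := congr1 p2 eqf.
rewrite !(tproj1E h_basis) !(tproj2E h_basis) => ff' Tff'.
have f'E : f' = - T f by apply: val_inj; rewrite linearN.
have : f = - f by rewrite {1}(val_inj ff' : f = T f') f'E linearN /= TT.
by move/eqP; rewrite -addr_eq0 -mulr2n -scaler_nat scaler_eq0 pnatr_eq0 => /eqP.
Qed.

Lemma val_fU f : vsval (f_U f) = ph f.
Proof. by rewrite corestrE // memv_img // memvf. Qed.

Lemma incl_fU f : incl U (f_U f) = ph f.
Proof. by rewrite inclE val_fU. Qed.

Lemma fU_bij : bijective f_U.
Proof.
have fK : cancel f_U (fun y => vsproj F (p1 (vsval y))).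
  move=> f; rewrite val_fU phi_endE tproj1E //; exact: vsvalK.
apply: (Bijective fK) => y; have /memv_imgP[f _ yf] := subvsP y.
have -> : y = f_U f by apply: val_inj; rewrite /= val_fU.
by rewrite fK.
Qed.

Lemma JU_fU f : J_U (f_U f) = f_U (T f).
Proof.
apply: val_inj; rewrite /= val_fU -swap_phi corestrE comp_lfunE incl_fU //.
by rewrite swap_phi memv_img // memvf.
Qed.

Lemma JU_wpc : weakly_para_complex J_U.
Proof.
apply/weakly_para_complexE => y; have [fi _ fiK] := fU_bij.
by rewrite -[y]fiK !JU_fU TT.
Qed.

Lemma graph_iso : weakly_para_complex_iso T J_U f_U.
Proof.
by split=> [|||f]; [exact: wT | exact: JU_wpc | exact: fU_bij | rewrite JU_fU].
Qed.

Lemma wFE f f' : w_F f f' = oE (vsval f) (vsval f').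
Proof. by rewrite -!inclE. Qed.

Lemma gFE f f' : g_F f f' = w_F f (T f') - w_F (T f) f'.
Proof.
rewrite -[g_F f f']/(g (incl U (f_U f)) (incl U (f_U f'))).
by rewrite !incl_fU !phi_endE tformE !wFE.
Qed.

Lemma gF_skew : skew_wrt g_F T.
Proof. by move=> f f'; rewrite !gFE !TT; ring. Qed.

Lemma gF_fU f f' : g_U (f_U f) (f_U f') = g_F f f'.
Proof. by []. Qed.

Lemma gU_skew : skew_wrt g_U J_U.
Proof.
move=> y z; have [fi _ fiK] := fU_bij.
by rewrite -[y]fiK -[z]fiK !JU_fU !gF_fU gF_skew.
Qed.

Lemma gU_nondegenerate : nondegenerate g_U = nondegenerate g_F.
Proof.
have [fi fK fiK] := fU_bij; apply/nondegenerateP/nondegenerateP => nd x gx0.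
  rewrite -[x]fK [f_U x]nd ?(can2_eq fK fiK) => [|y]; last first.
    by rewrite -[y]fiK gF_fU.
  by apply: (can_inj fK); rewrite fiK linear0.
rewrite -[x]fiK [fi x]nd ?linear0 // => y.
by rewrite -gF_fU fiK.
Qed.

(** Once the metric is non degenerate, [skew_para_complex] applied to [J_U] makes its eigenspaces
    equal in dimension; [gU_nondegenerate] moves the condition to [F]. *)
Lemma hermitian_graph : hermitian_sub g U J <-> nondegenerate g_F.
Proof.
rewrite -gU_nondegenerate; split=> [[] //|nd]; split=> //.
split; first exact: swap_sub_graph.
exact: (skew_para_complex nd JU_wpc gU_skew).2.
Qed.

Lemma wF_skew_invariant :
  skew_wrt w_F T <-> forall f f', w_F f f' = - w_F (T f) (T f').
Proof.
split=> [sk f f' | inv f f']; first by rewrite sk TT opprK.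
by rewrite inv TT.
Qed.

Lemma wF_skew_gF :
  skew_wrt w_F T <-> forall f f', g_F f f' = - (2 * w_F (T f) f').
Proof.
split=> [sk f f' | gE f f']; first by rewrite gFE !sk; ring.
by have := gE f f'; rewrite gFE => ?; lra.
Qed.

(** By [wF_skew_gF] the two forms differ by the factor -2 and the bijection [T] in one argument, so
    [T] matches their radicals. *)
Lemma skew_nondegenerate :
  skew_wrt w_F T -> nondegenerate w_F = nondegenerate g_F.
Proof.
move=> /wF_skew_gF gE; apply/nondegenerateP/nondegenerateP => nd f f0.
  have Tf0 : T f = 0.
    by apply: nd => f'; have := f0 f'; rewrite gE => ?; lra.
  by rewrite -[f]TT Tf0 linear0.
by rewrite -[f]TT [T f]nd ?linear0 // => f'; rewrite gE TT f0 mulr0 oppr0.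
Qed.

Lemma totally_para_complex_skew (I : 'End(tensor H E)) :
    compatible_complex I -> (I \o J)%VF = (- (J \o I))%VF ->
    (I @: U <= orthov g U)%VS ->
  skew_wrt w_F T.
Proof.
move=> [QI II] IJ /orthovP IU; have [a [c IE]] := in_Qt_anticommute QI IJ.
(* First component of [I (I (h1 (x) x)) = - h1 (x) x]. The relation is kept on vectors, as it says
   nothing about the scalars when [E] is zero. *)
have sq (x : E) : (a ^+ 2 - c ^+ 2) *: x = - x.
  have /(congr1 p1) :
      I (I (tensv h1 x + tensv h2 0)) = - (tensv h1 x + tensv h2 0).
    by rewrite -comp_lfunE II opp_lfunE id_lfunE.
  rewrite !IE !scaler0 !subr0 (linearN p1) /= !(tproj1E h_basis) => <-.
  by rewrite !scalerA -scalerBl.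
pose S (f f' : subvs_of F) := w_F f (T f') + w_F (T f) f'.
pose P (f f' : subvs_of F) := w_F f f' + w_F (T f) (T f').
(* Here [g (I (ph f)) (ph f')] expands to [a * S f f' - c * P f f']. *)
have aS f f' : a * S f f' = c * P f f'.
  have := IU (I (ph f)) (ph f').
  rewrite !memv_img ?memvf // => /(_ isT isT).
  rewrite phi_endE IE phi_endE tformE !linearBl /= !linearZl_LR /= /S /P !wFE.
  by move=> ?; lra.
(* Replacing [f] by [T f] exchanges [S] and [P]. *)
have aP f f' : a * P f f' = c * S f f'.
  by have := aS (T f) f'; rewrite /S /P TT => e;
     rewrite addrC e [X in c * X]addrC.
move=> f f'; rewrite wFE.
have : (a ^+ 2 - c ^+ 2) * S f f' = 0.
  by rewrite mulrBl !expr2 -!mulrA aS -aP; ring.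
have : (a ^+ 2 - c ^+ 2) * S f f' = - S f f'.
  have sqw y z : (a ^+ 2 - c ^+ 2) * w_F y z = - w_F y z.
    by rewrite !wFE -linearZl_LR /= sq linearNl.
  by rewrite /S mulrDr !sqw opprD.
by rewrite /S !wFE => -> ?; lra.
Qed.

(** The metric evaluates to [- w_F (T f) (T f') - w_F f f'], which is zero by skew-invariance. *)
Lemma skew_rotation_orthov :
  skew_wrt w_F T -> (rotation E h1 h2 @: U <= orthov g U)%VS.
Proof.
move=> sk; apply/orthovP => X Y /memv_imgP[_ /memv_imgP[f _ ->] ->].
case/memv_imgP=> f' _ ->.
rewrite rotationE // phi_endE tproj1E // tproj2E // phi_endE tformE.
have := (wF_skew_invariant.1 sk) f f'; rewrite !wFE linearNl /= => ?; lra.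
Qed.

Lemma totally_para_complex_graph :
  totally_para_complex_sub g U J <-> skew_wrt w_F T /\ nondegenerate w_F.
Proof.
split=> [[/hermitian_graph nd [I [cI IJ IU]]] | [sk nd]].
  by have sk := totally_para_complex_skew cI IJ IU; rewrite skew_nondegenerate.
split; first by apply/hermitian_graph; rewrite -skew_nondegenerate.
exists (rotation E h1 h2); split; first exact: rotation_complex.
  exact: rotation_swap.
exact: skew_rotation_orthov.
Qed.
End Graph.

(** * Pure stable subspaces as graphs *)

Lemma pure_swap_graph (U : {vspace tensor H E}) :
    pure U -> weakly_para_complex_sub U J ->
  exists (F : {vspace E}) (T : 'End(subvs_of F)),
    [/\ F = (p1 @: U)%VS, weakly_para_complex T & U = UFT h1 h2 (endE T)].
Proof.
move=> pureU JU; have memJ X : X \in U -> J X \in U.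
  by move=> XU; apply: subvP JU _ (memv_img _ XU).
have inj X : X \in U -> p1 X = 0 -> X = 0.
  move=> XU p1X; set e := p2 X.
  have XE : X = tensv h2 e.
    by rewrite (tproj_decomp h_basis X) p1X linear0r add0r.
  (* This is [H (x) e]. It is para-quaternionic because [in_Qt] maps act on the first factor only,
     and it lies in [U] because [J X = h1 (x) e]. *)
  pose He := (<[tensv h1 e]> + <[tensv h2 e]>)%VS.
  have tensHe h : tensv h e \in He.
    rewrite (basis2E h_basis h) linearDl !linearZl_LR /=.
    by rewrite memv_add // memvZ // memv_line.
  have : He = 0%VS.
    apply: pureU.
      by rewrite subv_add -!memvE -XE XU -Jh2 -XE memJ.
    by move=> S [A _ SA]; rewrite limgD !limg_line subv_add -!memvE !SA !tensHe.
  by move=> He0; apply/eqP; rewrite -memv0 -He0 XE tensHe.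
pose F := (p1 @: U)%VS.
(* The inverse of a linear map is only a generalized one here: [s] is a right inverse of [p1] on [F]
   alone, but takes values in [U] everywhere. *)
have [s sU sK] : exists2 s : 'Hom(E, tensor H E),
    forall e, s e \in U & {in F, forall e, p1 (s e) = e}.
  exists (incl U \o (p1 \o incl U)^-1)%VF => [e | _ /memv_imgP[X XU ->]].
    by rewrite comp_lfunE inclE subvsP.
  have /limg_lfunVK : p1 X \in limg (p1 \o incl U)%VF.
    rewrite -(vsprojK XU) -inclE -comp_lfunE.
    by rewrite memv_img ?memvf.
  by move=> qK; rewrite -[RHS]qK [RHS]comp_lfunE [in LHS]comp_lfunE.
pose T : 'End(subvs_of F) := corestr F (p1 \o J \o s \o incl F)%VF.
have valT f : vsval (T f) = p1 (J (s (vsval f))).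
  rewrite corestrE !comp_lfunE inclE //.
  exact: (memv_img p1 (memJ _ (sU _))).
(* Both sides lie in [U] and have the same first component. Hence [s] intertwines [T] and [J], and
   [T] inherits [J^2 = Id]. *)
have sT f : s (vsval (T f)) = J (s (vsval f)).
  apply/eqP; rewrite -subr_eq0; apply/eqP/inj; first by rewrite memvB ?memJ.
  by rewrite linearB /= sK ?subvsP // valT subrr.
have wT : weakly_para_complex T.
  apply/weakly_para_complexE => f; apply: val_inj.
  by rewrite /= valT sT swap_tensorK sK ?subvsP.
have phiT f : phi h1 h2 (endE T) f = s (vsval f).
  rewrite phi_endE valT swap_tensorE tproj1E //.
  by rewrite [RHS](tproj_decomp h_basis) sK ?subvsP.
exists F, T; split=> //; apply/vspaceP => X.
apply/idP/memv_imgP => [XU|[f _ ->]].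
  have p1F : p1 X \in F by rewrite memv_img.
  exists (vsproj F (p1 X)); rewrite ?memvf // phiT vsprojK //.
  apply/eqP; rewrite -subr_eq0; apply/eqP/inj; first by rewrite memvB.
  by rewrite linearB /= sK // subrr.
by rewrite phiT.
Qed.
End Pencil.

Unset Implicit Arguments.

Theorem theorem3p22 (R : realType) (n : nat) (H E : vectType R)
    (dimH : \dim {:H} = 2%N) (dimE : \dim {:E} = (2 * n)%N)
    (oH : {skew_symmetric H}) (oH_symp : is_psymplectic oH)
    (oE : {skew_symmetric E}) (oE_symp : is_psymplectic oE)
    (J : 'End(tensor H E)) (J_compat : compatible_para_complex J)
    (h1 h2 : H) (h_symp : symplectic_basis oH h1 h2)
    (Jh1 : forall e : E, J (tensv h1 e) = tensv h2 e)
    (Jh2 : forall e : E, J (tensv h2 e) = tensv h1 e) :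
  let g : {symmetric tensor H E} := tform oH oE in
  let p1 : 'Hom(tensor H E, E) := tproj E h1 h2 0 in
  (forall U : {vspace tensor H E},
     (pure U /\ weakly_para_complex_sub U J) <->
     (exists (F : {vspace E}) (T : 'End(subvs_of F)),
        [/\ F = (p1 @: U)%VS, weakly_para_complex T
          & U = UFT h1 h2 (endE T)]))
  /\
  (forall (U : {vspace tensor H E}) (F : {vspace E}) (T : 'End(subvs_of F)),
     F = (p1 @: U)%VS -> weakly_para_complex T -> U = UFT h1 h2 (endE T) ->
     let f_U : 'Hom(subvs_of F, subvs_of U) :=
       corestr U (phi h1 h2 (endE T)) in
     let J_U : 'End(subvs_of U) := restr U J in
     let g_U : {symmetric subvs_of U} := form_on g U in
     let g_F : {symmetric subvs_of F} := pullback g_U f_U in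
     let w_F : {skew_symmetric subvs_of F} := form_on oE F in
     (* (a) *)
     weakly_para_complex_iso T J_U f_U
     /\
     (* (b) *)
     [/\ hermitian_sub g U J <-> nondegenerate g_F,
         nondegenerate g_F -> para_complex T
       & hermitian_sub g U J ->
         [/\ neutral g_U, hermitian_para_complex_iso T g_F J_U g_U f_U
           & skew_wrt g_F T]]
     /\
     (* (c) *)
     (forall f f' : subvs_of F,
        g_U (J_U (f_U f)) (f_U f') = g_F (T f) f' /\
        g_F (T f) f' = - (w_F f f' - w_F (T f) (T f')))
     /\
     (* (d) *)
     (para_complex_sub U J ->
        (totally_para_complex_sub g U J <->
         skew_wrt w_F T /\ nondegenerate w_F))
     /\
     (skew_wrt w_F T <-> (forall f f' : subvs_of F, w_F f f' = - w_F (T f) (T f')))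
     /\
     (skew_wrt w_F T <-> (forall f f' : subvs_of F, g_F f f' = - (2 * w_F (T f) f')))).
Proof.
split=> [U | U F T FE wT UE].
  split=> [[pureU JU] | [F [T [_ wT ->]]]].
    exact: (pure_swap_graph h_symp Jh1 Jh2 pureU JU).
  split; first exact: (pure_graph h_symp wT).
  exact: (swap_sub_graph h_symp Jh1 Jh2 wT).
subst U => f_U J_U g_U g_F w_F.
have TT := (weakly_para_complexE T).1 wT.
have hermE := hermitian_graph oE h_symp Jh1 Jh2 wT.
have iso := graph_iso h_symp Jh1 Jh2 wT.
have skF : skew_wrt g_F T := gF_skew oE h_symp wT.
split; first exact: iso.
split.
  split; [exact: hermE | by move=> nd; exact: skew_para_complex nd wT skF |].
  move=> /hermE ndF.
  have ndU : nondegenerate g_U by rewrite /g_U (gU_nondegenerate oE h_symp).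
  have wJ : weakly_para_complex J_U := JU_wpc h_symp Jh1 Jh2 wT.
  have skU : skew_wrt g_U J_U := gU_skew oE h_symp Jh1 Jh2 wT.
  split; [exact: skew_neutral ndU wJ skU | | exact: skF].
  split; [ | | exact: iso | by []].
    by split=> //; exact: skew_para_complex ndF wT skF.
  by split=> //; exact: skew_para_complex ndU wJ skU.
split=> [f f' | ].
  split; first by rewrite /f_U /J_U (JU_fU h_symp Jh1 Jh2 wT).
  (* At [T f], [gFE] gives [w_F (T f) (T f') - w_F (T (T f)) f']. *)
  by rewrite /g_F (gFE oE h_symp) TT opprB.
split.
  by move=> _; exact: (totally_para_complex_graph oE h_symp Jh1 Jh2 wT).
split; first exact: (wF_skew_invariant oE wT).
exact: (wF_skew_gF oE h_symp).
Qed.
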